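(* Let $\mathbf{L}=\langle L,\wedge,\vee,\otimes,\rightarrow,0,1\rangle$ be a complete residuated lattice. Let $\mathcal{D}_1$ and $\mathcal{D}'_1$ be ranked data tables on a relation scheme $R$ and let $\mathcal{D}_2$ and $\mathcal{D}'_2$ be ranked data tables on a relation scheme $T$ such that $R\cap T=\emptyset$. Then $$S(\mathcal{D}_1,\mathcal{D}'_1)\otimes S(\mathcal{D}_2,\mathcal{D}'_2)\leq S(\mathcal{D}_1\times\mathcal{D}_2,\mathcal{D}'_1\times\mathcal{D}'_2).$$
   Context: A complete residuated lattice $\mathbf{L}=\langle L,\wedge,\vee,\otimes,\rightarrow,0,1\rangle$ is a complete lattice with least element $0$ and greatest element $1$ such that $\langle L,\otimes,1\rangle$ is a commutative monoid and, for all $a,b,c\in L$, $a\otimes b\leq c$ if and only if $a\leq b\rightarrow c$. $Y$ is a set of attributes; a relation scheme is any subset $T\subseteq Y$. Each $y\in Y$ has a domain $D_y$ (a set) equipped with a similarity $\approx_y\colon D_y\times D_y\to L$, i.e., $u\approx_y u=1$ and $u\approx_y v=v\approx_y u$ for all $u,v\in D_y$. Put $\mathrm{Tupl}(T)=\prod_{y\in T}D_y$; its elements $t$ (maps with $t(y)\in D_y$ for $y\in T$) are tuples over $T$. A ranked data table (RDT) on $T$ is a (finite) $\mathbf{L}$-set in $\mathrm{Tupl}(T)$, i.e., a map $\mathcal{D}\colon\mathrm{Tupl}(T)\to L$ (finite meaning that only finitely many tuples have nonzero value). For $R\cap T=\emptyset$, $r\in\mathrm{Tupl}(R)$, $t\in\mathrm{Tupl}(T)$,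 the concatenation $rt\in\mathrm{Tupl}(R\cup T)$ is given by $(rt)(y)=r(y)$ for $y\in R$ and $(rt)(y)=t(y)$ for $y\in T$. The Cartesian product of RDTs $\mathcal{D}_1$ on $R$ and $\mathcal{D}_2$ on $T$ is the RDT on $R\cup T$ given by $(\mathcal{D}_1\times\mathcal{D}_2)(rt)=\mathcal{D}_1(r)\otimes\mathcal{D}_2(t)$. For RDTs $\mathcal{D},\mathcal{D}'$ on the same scheme $T$, the subsethood degree is $S(\mathcal{D},\mathcal{D}')=\bigwedge_{t\in\mathrm{Tupl}(T)}\bigl(\mathcal{D}(t)\rightarrow\mathcal{D}'(t)\bigr)\in L$. *)

(* Defs.v *)
From HB Require Import structures.
From mathcomp Require Import all_boot all_order.
From mathcomp Require Import boolp classical_sets functions cardinality.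

Set Implicit Arguments.
Unset Strict Implicit.
Unset Printing Implicit Defensive.

Import Order.TTheory.
Local Open Scope order_scope.
Local Open Scope classical_set_scope.

(* The case \bot = \top is not excluded. *)
HB.mixin Record isCompleteResiduated d L of Order.TBLattice d L := {
  supremums_neq0 : forall A : set L, supremums A !=set0;
  infimums_neq0 : forall A : set L, infimums A !=set0;
  otimes : L -> L -> L;
  residuum : L -> L -> L;
  otimesA : associative otimes;
  otimesC : commutative otimes;
  otimes1l : left_id \top otimes;
  otimes_residuum : forall a b c : L,
    otimes a b <= c <-> a <= residuum b c
}.

#[short(type="completeResiduatedLatticeType")]
HB.structure Definition CompleteResiduatedLattice d :=
  { L of isCompleteResiduated d L & Order.TBLattice d L }.

Notation "a ⊗ b" := (otimes a b) (at level 40, left associativity) : order_scope.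
Notation "a ⟶ b" := (residuum a b) (at level 55, right associativity) : order_scope.

Section ResiduatedLattice.
Context {d : Order.disp_t} {L : completeResiduatedLatticeType d}.
Implicit Types (a b : L) (A : set L).

(* The default value \top of infimum only serves for A = set0, whose greatest
   lower bound it is; every set has an infimum here. *)
Definition bigmeet A : L := infimum \top A.

Lemma bigmeetP A : infimums A (bigmeet A).
Proof.
rewrite /bigmeet /infimum; case: ifPn => [/eqP->|_].
  by split=> [x []|x _]; exact: lex1.
by case: xgetP => [x _ //|/= none]; case: (infimums_neq0 A) => x /none.
Qed.

Lemma otimes0l b : \bot ⊗ b = \bot :> L.
Proof. by apply/eqP; rewrite -lex0; apply/otimes_residuum; exact: le0x. Qed.

Lemma otimes0r a : a ⊗ \bot = \bot :> L.
Proof. by rewrite otimesC otimes0l. Qed.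

End ResiduatedLattice.

Record simDomain d (L : completeResiduatedLatticeType d) := SimDomain {
  dom_sort :> Type;
  sim : dom_sort -> dom_sort -> L;
  sim_refl : forall u, sim u u = \top;
  sim_sym : forall u v, sim u v = sim v u
}.

Section RankedDataTables.
Context {d : Order.disp_t} {L : completeResiduatedLatticeType d}.
Context {Y : Type} (D : Y -> simDomain L).
Implicit Types (R T U : set Y) (fin : bool).

Definition Tupl T : Type := forall y : T, D (val y).

(* A ranked data table is a "(finite)" L-set of tuples: with fin = true only
   the L-sets with finite support are allowed, with fin = false all L-sets are.
   Results stated for every fin hold under both conventions. *)
Record RDT fin T := MkRDT {
  rdt_fun :> Tupl T -> L;
  rdt_finite : fin -> finite_set [set t | rdt_fun t != \bot]
}.

Definition restr R T (sRT : R `<=` T) (s : Tupl T) : Tupl R :=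
  fun y => s (SigSub (mem_set (sRT _ (set_valP y)))).

Lemma setU_Nl R T y : (R `|` T) y -> ~ R y -> T y.
Proof. by case. Qed.

Definition concat R T (r : Tupl R) (t : Tupl T) : Tupl (R `|` T) :=
  fun y => match pselect (R (val y)) with
  | left Ry => r (SigSub (mem_set Ry))
  | right NRy => t (SigSub (mem_set (setU_Nl (set_valP y) NRy)))
  end.

Lemma Tupl_irrel T (s : Tupl T) y (p q : y \in T) :
  s (SigSub p) = s (SigSub q).
Proof. by rewrite (bool_irrelevance p q). Qed.

Lemma restr_concatl R T (r : Tupl R) (t : Tupl T) :
  restr (@subsetUl _ R T) (concat r t) = r.
Proof.
apply: functional_extensionality_dep => -[y p]; rewrite /restr /concat /=.
by case: pselect => [Ry|NRy]; [exact: Tupl_irrel|case: NRy; exact: set_mem].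
Qed.

Lemma restr_concatr R T (r : Tupl R) (t : Tupl T) : R `&` T = set0 ->
  restr (@subsetUr _ R T) (concat r t) = t.
Proof.
move=> RT0; apply: functional_extensionality_dep => -[y p].
rewrite /restr /concat /=; case: pselect => [Ry|NRy]; last exact: Tupl_irrel.
have: (R `&` T) y by split=> //; exact: set_mem.
by rewrite RT0.
Qed.

Lemma concat_restr R T (s : Tupl (R `|` T)) :
  concat (restr (@subsetUl _ R T) s) (restr (@subsetUr _ R T) s) = s.
Proof.
apply: functional_extensionality_dep => -[y p]; rewrite /restr /concat /=.
by case: pselect => H; exact: Tupl_irrel.
Qed.

(* For disjoint R and T, concat is a bijection with inverse given by the two
   restrictions, so this is the function determined by
   concat r t |-> D1 r ⊗ D2 t, see cartE. *)
Definition cart_fun R T (D1 : Tupl R -> L) (D2 : Tupl T -> L)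
    (s : Tupl (R `|` T)) : L :=
  D1 (restr (@subsetUl _ R T) s) ⊗ D2 (restr (@subsetUr _ R T) s).

Lemma cart_finite fin R T (D1 : RDT fin R) (D2 : RDT fin T) :
  fin -> finite_set [set s | cart_fun D1 D2 s != \bot].
Proof.
move=> finT; pose c (p : Tupl R * Tupl T) := concat p.1 p.2.
have fX := finite_setX (rdt_finite D1 finT) (rdt_finite D2 finT).
apply: sub_finite_set (finite_image c fX) => s /= Ds.
exists (restr (@subsetUl _ R T) s, restr (@subsetUr _ R T) s); last first.
  exact: concat_restr.
split=> /=; apply: contra_neq Ds => D0; rewrite /cart_fun D0.
  exact: otimes0l.
exact: otimes0r.
Qed.

Definition cart fin R T (D1 : RDT fin R) (D2 : RDT fin T) :
    RDT fin (R `|` T) :=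
  MkRDT (cart_finite D1 D2).

Lemma cartE fin R T (D1 : RDT fin R) (D2 : RDT fin T) (r : Tupl R)
    (t : Tupl T) :
  R `&` T = set0 -> cart D1 D2 (concat r t) = D1 r ⊗ D2 t.
Proof.
by move=> RT0; rewrite /cart /cart_fun /= restr_concatl restr_concatr.
Qed.

Definition subsethood fin T (D1 D2 : RDT fin T) : L :=
  bigmeet [set (D1 t ⟶ D2 t) | t in [set: Tupl T]].

End RankedDataTables.

(* Main.v *)
Require Import Defs.
From mathcomp Require Import all_boot all_order.
From mathcomp Require Import boolp classical_sets functions cardinality.
Import Order.POrderTheory.
Local Open Scope order_scope.
Local Open Scope classical_set_scope.

Section ResiduatedLattice.
Context {d : Order.disp_t} {L : completeResiduatedLatticeType d}.
Implicit Types a b c : L.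

(** The value of a product at a tuple [s] is the ⊗ of the factors' values at the restrictions of [s]
    to [R] and [T]. Each subsethood degree is below its own term at the matching restriction, and
    [otimes_residuum_le] combines the two terms into the term of the products at [s]. As [s] is
    arbitrary, the left side is a lower bound, hence below the infimum. *)

Lemma le_otimes2r c a b : a <= b -> a ⊗ c <= b ⊗ c.
Proof.
move=> ab; apply/otimes_residuum; apply: (le_trans ab).
(* The goal [b <= c ⟶ b ⊗ c] is adjoint to reflexivity at [b ⊗ c]. *)
exact/otimes_residuum.
Qed.

Lemma le_otimes a b a' b' : a <= a' -> b <= b' -> a ⊗ b <= a' ⊗ b'.
Proof.
move=> aa' bb'; apply: le_trans (le_otimes2r b _ _ aa') _.
by rewrite otimesC [a' ⊗ _]otimesC; exact: le_otimes2r.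
Qed.

Lemma residuum_mp a b : (a ⟶ b) ⊗ a <= b.
Proof. exact/otimes_residuum. Qed.

Lemma otimesACA : interchange (@otimes d L) otimes.
Proof. by move=> a b a' b'; rewrite -!otimesA (otimesA b) (otimesC b) -(otimesA a'). Qed.

(** By adjunction, multiply the left side by [a ⊗ b]; regrouping pairs each residuum with its
    antecedent, so [residuum_mp] applies to both factors. *)
Lemma otimes_residuum_le a b a' b' :
  (a ⟶ a') ⊗ (b ⟶ b') <= (a ⊗ b) ⟶ (a' ⊗ b').
Proof.
apply: (otimes_residuum _ _ _).1; rewrite otimesACA.
by apply: le_otimes; exact: residuum_mp.
Qed.

End ResiduatedLattice.

Section Subsethood.
Context {d : Order.disp_t} {L : completeResiduatedLatticeType d}.
Context {Y : Type} {D : Y -> simDomain L} {fin : bool} {T : set Y}.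

Lemma subsethood_le (D1 D2 : RDT D fin T) t : subsethood D1 D2 <= D1 t ⟶ D2 t.
Proof.
have [lb _] := bigmeetP [set (D1 t ⟶ D2 t) | t in [set: Tupl D T]].
by apply: lb; exists t.
Qed.

Lemma le_subsethood (D1 D2 : RDT D fin T) a :
  (forall t, a <= D1 t ⟶ D2 t) -> a <= subsethood D1 D2.
Proof.
move=> aD; have [_] := bigmeetP [set (D1 t ⟶ D2 t) | t in [set: Tupl D T]].
by apply=> _ [t _ <-]; exact: aD.
Qed.

End Subsethood.

Theorem theorem2 (d : Order.disp_t) (L : completeResiduatedLatticeType d)
    (Y : Type) (D : Y -> simDomain L) (fin : bool) (R T : set Y)
    (D1 D1' : RDT D fin R) (D2 D2' : RDT D fin T) :
  R `&` T = set0 ->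
  subsethood D1 D1' ⊗ subsethood D2 D2' <= subsethood (cart D1 D2) (cart D1' D2').
Proof.
move=> _; apply: le_subsethood => s.
(* Unification unfolds [cart] at [s], so the four elements are the values of the tables at the
   restrictions of [s]. *)
apply: le_trans (otimes_residuum_le _ _ _ _).
by apply: le_otimes; exact: subsethood_le.
Qed.
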